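(* Let $n\in\mathbb{N}_0$ and define $$y\left(n,\tfrac12\right)=\sum_{j=0}^{n}\frac{(-1)^{n}}{(j+1)\left(\tfrac12\right)^{j+1}\left(\tfrac12-1\right)^{n+1-j}}.$$ Then $$y\left(n,\tfrac12\right)=2^{n+2}\left(\frac{(-1)^{n+1}}{n+1}+H_{\lfloor n/2\rfloor}-\gamma-\psi(n+1)\right),$$ where $H_m=\sum_{k=1}^m\frac1k$ ($H_0=0$) are the harmonic numbers, $\gamma$ is the Euler–Mascheroni constant, $\psi(z)=\frac{d}{dz}\log\Gamma(z)$ is the digamma function, and $\lfloor\cdot\rfloor$ is the integer part. *)

(* Defs.v *)
From HB Require Import structures.
From mathcomp Require Import all_boot all_order all_algebra.
From mathcomp Require Import all_classical all_reals all_analysis.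

Set Implicit Arguments.
Unset Strict Implicit.
Unset Printing Implicit Defensive.

Import Order.TTheory GRing.Theory Num.Theory.
Import numFieldNormedType.Exports.

Local Open Scope classical_set_scope.
Local Open Scope ring_scope.

(* In the range j <= n of the sum, the exponent n.+1 - j is not truncated. *)
Definition ynum {R : realType} (n : nat) (lambda : R) : R :=
  \sum_(0 <= j < n.+1)
    (-1) ^+ n /
    (j.+1%:R * lambda ^+ j.+1 * (lambda - 1) ^+ (n.+1 - j)).

Definition harmonic_number {R : realType} (m : nat) : R :=
  \sum_(1 <= k < m.+1) k%:R^-1.

(* limn is total: the sequence does converge. The term at m = 0 is
   irrelevant to the limit. *)
Definition euler_mascheroni {R : realType} : R :=
  limn (fun m : nat => harmonic_number m - ln (m%:R : R)).

(* Euler's integral of the second kind; meaningful for 0 < z. *)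
Definition Gamma {R : realType} (z : R) : R :=
  \int[lebesgue_measure]_(t in `]0, +oo[) (t `^ (z - 1) * expR (- t)).

(* The derivative is taken along the real line; meaningful for 0 < z, where
   Gamma is positive and ln is the usual logarithm. *)
Definition digamma {R : realType} (z : R) : R :=
  derive1 (fun x : R => ln (Gamma x)) z.

(* Main.v *)
(** At lambda = 1/2 the sum y(n, 1/2) collapses to 2^(n+2) times an alternating
    harmonic sum, so the point is the value psi(n+1) = H_n - gamma.  Euler's
    integral satisfies Gamma(s+1) = s Gamma(s) (integration by parts on
    [1/(k+2), k+2], then k -> oo) and, by Bernoulli's inequality for t^p under
    the integral sign, Wendel's bound Gamma(s+p) <= s^p Gamma(s) for p in [0,1].
    After shifting s by M with the functional equation, these pin the difference
    quotient of ln Gamma at x, with increment h, to within 8|h| of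
    lim_M (ln(x+M) - sum_(k<M) 1/(x+k)), which is H_n - gamma for x = n+1. *)

Require Import Defs.
From mathcomp Require Import all_boot all_order all_algebra.
From mathcomp Require Import all_classical all_reals all_analysis.
From mathcomp Require Import measurable_realfun ring lra.

Import Order.TTheory GRing.Theory Num.Theory.
Import numFieldNormedType.Exports.

Local Open Scope classical_set_scope.
Local Open Scope ring_scope.

(** * The integrand of Euler's integral and its regularity on the positive half-line *)

Definition euler_kernel {R : realType} (s t : R) : R := t `^ (s - 1) * expR (- t).

Lemma euler_kernel_ge0 (R : realType) (s t : R) : 0 <= euler_kernel s t.
Proof. by rewrite mulr_ge0 ?powR_ge0 ?expR_ge0. Qed.

Lemma euler_kernelD (R : realType) (s p t : R) : 0 < t ->
  euler_kernel (s + p) t = t `^ p * euler_kernel s t.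
Proof.
move=> t0; rewrite /euler_kernel mulrA -powRD; last by rewrite (gt_eqF t0) implybT.
by congr (_ `^ _ * _); ring.
Qed.

Lemma measurable_euler_kernel (R : realType) (s : R) (D : set R) :
  measurable_fun D (fun t => (euler_kernel s t)%:E).
Proof.
apply/measurable_EFinP; apply: (@measurable_funTS _ _ _ _ D).
apply: measurable_funM; first exact: measurable_powR.
by apply: measurableT_comp => //; exact: measurable_funN.
Qed.

Lemma is_derive_expRN (R : realType) (t : R) :
  is_derive t 1 (fun x : R => expR (- x)) (- expR (- t)).
Proof.
have := @is_derive1_comp R expR (fun x => - x) t (expR (- t)) (-1).
by rewrite mulrN1; apply; exact: is_deriveNid.
Qed.

Lemma continuous_expRN (R : realType) : continuous (fun x : R => expR (- x)).
Proof.
by move=> t; apply: continuous_comp; [exact: opp_continuous | exact: continuous_expR].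
Qed.

Lemma is_deriveN_expRN (R : realType) (t : R) :
  is_derive t 1 (fun x : R => - expR (- x)) (expR (- t)).
Proof.
have H := is_derive_expRN R t.
by apply: is_derive_eq; rewrite opprK.
Qed.

Lemma within_continuous_gt0 (R : realType) (f : R -> R) (a b : R) : 0 < a ->
  (forall x, 0 < x -> {for x, continuous f}) -> {within `[a, b], continuous f}.
Proof.
move=> a0 cf; apply: continuous_in_subspaceT => x.
by rewrite inE /= in_itv/= => /andP[ax _]; apply/cf/(lt_le_trans a0).
Qed.

Lemma powR_continuous_at (R : realType) (s x : R) :
  0 < x -> {for x, continuous (fun t : R => t `^ s)}.
Proof.
move=> x0; apply/differentiable_continuous/derivable1_diffP.
by apply: derivable_powR; rewrite in_itv/= x0.
Qed.

Lemma derivable_oo_LRcontinuous_gt0 (R : realType) (f : R -> R) (a b : R) :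
  0 < a -> a < b -> (forall x, 0 < x -> derivable f x 1) ->
  derivable_oo_LRcontinuous f a b.
Proof.
move=> a0 ab df.
have cf x : 0 < x -> {for x, continuous f}.
  by move=> x0; apply/differentiable_continuous/derivable1_diffP/df.
split.
- by move=> x; rewrite in_itv/= => /andP[ax _]; apply/df/(lt_trans a0).
- exact/cvg_at_right_filter/cf.
- exact/cvg_at_left_filter/cf/(lt_trans a0).
Qed.

(** Integration by parts with t^s and the antiderivative -exp(-t); keeping [a] above 0 makes t^s
    differentiable on the whole segment even when s < 1. *)
Lemma euler_kernel_segment (R : realType) (s a b : R) : 0 < s -> 0 < a -> a < b ->
  (\int[lebesgue_measure]_(t in `[a, b]) (euler_kernel (s + 1) t)%:E =
   s%:E * \int[lebesgue_measure]_(t in `[a, b]) (euler_kernel s t)%:E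
   + (a `^ s * expR (- a) - b `^ s * expR (- b))%:E)%E.
Proof.
move=> s0 a0 ab.
have := @integration_by_parts R (fun t => t `^ s) (fun t => - expR (- t))
  (fun t => s * t `^ (s - 1)) (fun t => expR (- t)) a b ab.
have -> : (fun x : R => ((fun t => t `^ s) x * (fun t => expR (- t)) x)%:E) =
   (fun x => (euler_kernel (s + 1) x)%:E).
  by apply/funext => t; rewrite /euler_kernel addrK.
move=> ->.
- have -> : (fun x : R => (s * x `^ (s - 1) * - expR (- x))%:E) =
     (fun x => ((- s)%:E * (euler_kernel s x)%:E)%E).
    by apply/funext => t; rewrite -EFinM /euler_kernel mulrN mulNr mulrA.
  rewrite integralZl//.
    by rewrite EFinN mulNe oppeK addeC; congr (_ + _%:E)%E; ring.
  apply: continuous_compact_integrable; first exact: segment_compact.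
  apply: within_continuous_gt0 => // x x0; apply: continuousM.
    exact: powR_continuous_at.
  exact: continuous_expRN.
- apply: within_continuous_gt0 => // x x0.
  by apply: continuousM; [exact: cst_continuous|exact: powR_continuous_at].
- by apply: derivable_oo_LRcontinuous_gt0 => // x x0; apply: derivable_powR; rewrite in_itv/= x0.
- move=> x; rewrite in_itv/= => /andP[ax _]; rewrite powR_derive1// in_itv/= andbT.
  exact: lt_trans ax.
- by apply: within_continuous_gt0 => // x _; exact: continuous_expRN.
- by apply: derivable_oo_LRcontinuous_gt0 => // x _; case: (is_deriveN_expRN R x).
- by move=> x _; rewrite derive1E; case: (is_deriveN_expRN R x).
Qed.

(** * Vanishing boundary terms and exhaustion of the half-line by segments *)

Lemma cvg_invnS2 (R : realType) : (k.+2%:R^-1 : R) @[k --> \oo] --> (0 : R).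
Proof.
have /(_ R) := @cvg_harmonic; rewrite -cvg_shiftS; exact.
Qed.

(** The exponential dominates its Taylor term of degree m+1, one degree above x^m >= x^s; this
    leaves the decaying factor 1/x. *)
Lemma powR_expRN_le (R : realType) (s x : R) (m : nat) : 1 <= x -> s <= m%:R ->
  x `^ s * expR (- x) <= m.+1`!%:R / x.
Proof.
move=> x1 sm; have x0 : 0 < x by apply: lt_le_trans x1.
have f0 : (0 : R) < m.+1`!%:R by rewrite ltr0n fact_gt0.
have Hs : x `^ s <= x ^+ m by rewrite -(powR_mulrn _ (ltW x0)); exact: ler_powR.
have He := expR_ge1Dxn m (ltW x0).
rewrite expRN ler_pdivlMr// mulrAC ler_pdivrMr ?expR_gt0//.
apply: (@le_trans _ _ (x ^+ m.+1)).
  by rewrite exprSr ler_wpM2r// ltW.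
rewrite mulrC -ler_pdivrMr//; apply: le_trans He.
by rewrite lerDr.
Qed.

Lemma cvg_powR_expRN_natr (R : realType) (s : R) :
  ((k.+2%:R : R) `^ s * expR (- k.+2%:R)) @[k --> \oo] --> (0 : R).
Proof.
have [m sm] : exists m : nat, s <= m%:R.
  by exists (Num.truncn `|s|).+1; rewrite (le_trans (ler_norm s))// ltW// truncnS_gt.
apply: (@squeeze_cvgr _ _ _ _ (fun=> 0) (fun k => m.+1`!%:R * k.+2%:R^-1)).
- apply: nearW => k; rewrite mulr_ge0 ?powR_ge0 ?expR_ge0//=.
  by apply: powR_expRN_le => //; rewrite ler1n.
- exact: cvg_cst.
- rewrite -[X in _ --> X](mulr0 (m.+1`!%:R)); apply: cvgMl_tmp.
  exact: cvg_invnS2.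
Qed.

Lemma cvg_powR_expRN_invn (R : realType) (s : R) : 0 < s ->
  ((k.+2%:R^-1 : R) `^ s * expR (- k.+2%:R^-1)) @[k --> \oo] --> (0 : R).
Proof.
move=> s0.
have h0 : (k.+2%:R^-1 : R) @[k --> \oo] --> (0 : R).
  exact: cvg_invnS2.
rewrite -[X in _ --> X](mul0r (expR (- 0))); apply: cvgM.
  by move/cvg_at_rightP: (@powR_cvg0 R s s0); apply; split=> // k; rewrite invr_gt0.
exact: (cvg_comp _ _ h0 (@continuous_expRN R 0)).
Qed.

(** The offset 2 gives 1/(k+2) < 1 < k+2, so the segment is nondegenerate already at k = 0. *)
Definition exhaust {R : realType} (k : nat) : set R := `[k.+2%:R^-1, k.+2%:R]%classic.

Lemma exhaust_bigcup (R : realType) : \bigcup_k exhaust k = `]0, +oo[%classic :> set R.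
Proof.
apply/seteqP; split => x.
  move=> [k _]; rewrite /exhaust /= !in_itv/= andbT => /andP[kx _].
  by apply: lt_le_trans kx; rewrite invr_gt0.
rewrite /= in_itv/= andbT => x0.
set y := Num.max x x^-1.
have xy : x <= y by rewrite /y le_max lexx.
have Vxy : x^-1 <= y by rewrite /y le_max lexx orbT.
have y0 : 0 < y by apply: lt_le_trans xy.
have yk : y <= (Num.truncn y).+2%:R.
  by rewrite (le_trans (ltW (truncnS_gt y)))// ler_nat.
exists (Num.truncn y) => //; rewrite /exhaust /= in_itv/= (le_trans xy yk) andbT.
by rewrite invf_ple ?posrE// (le_trans Vxy yk).
Qed.

Lemma exhaust_nondecreasing (R : realType) : nondecreasing_seq (@exhaust R).
Proof.
move=> m n mn; apply/subsetPset => x; rewrite /exhaust /= !in_itv/= => /andP[xm mx].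
rewrite (le_trans _ xm) ?lef_pV2 ?posrE ?ler_nat ?ltnS//=.
by rewrite (le_trans mx)// ler_nat ltnS.
Qed.

(** * Euler's integral in the extended reals: functional equation, finiteness, positivity *)

Definition eGamma {R : realType} (s : R) : \bar R :=
  (\int[lebesgue_measure]_(t in [set` `](0 : R)%R, +oo[%R]) (euler_kernel s t)%:E)%E.

Lemma eGamma_ge0 (R : realType) (s : R) : (0 <= eGamma s)%E.
Proof. by apply: integral_ge0 => t _; rewrite lee_fin euler_kernel_ge0. Qed.

Lemma cvg_eGamma (R : realType) (s : R) :
  (\int[lebesgue_measure]_(t in exhaust k) (euler_kernel s t)%:E)%E @[k --> \oo]
  --> eGamma s.
Proof.
rewrite /eGamma -exhaust_bigcup; apply: ge0_nondecreasing_set_cvg_integral.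
- exact: exhaust_nondecreasing.
- by move=> i; exact: measurable_itv.
- by move=> i; exact: measurable_euler_kernel.
- by move=> i x _; rewrite lee_fin euler_kernel_ge0.
Qed.

(** Stated in the extended reals because finiteness of [eGamma] is deduced from it. *)
Lemma eGammaD1 (R : realType) (s : R) : 0 < s -> eGamma (s + 1) = (s%:E * eGamma s)%E.
Proof.
move=> s0; apply: (cvg_unique _ (@cvg_eGamma R (s + 1))) => //.
have -> : (fun k => (\int[lebesgue_measure]_(t in exhaust k) (euler_kernel (s + 1) t)%:E)%E) =
  (fun k => (s%:E * \int[lebesgue_measure]_(t in exhaust k) (euler_kernel s t)%:E +
   ((k.+2%:R^-1 : R) `^ s * expR (- k.+2%:R^-1) -
    (k.+2%:R : R) `^ s * expR (- k.+2%:R))%:E)%E).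
  apply/funext => k; apply: euler_kernel_segment => //.
  have k1 : (1 : R) < k.+2%:R by rewrite ltr1n.
  by rewrite (lt_trans _ k1)// invf_lt1.
rewrite -(adde0 (s%:E * _)%E).
apply: (@cvgeD _ _ _ _ _ _ (s%:E * eGamma s)%E 0%E).
(* [eGamma s] may still be +oo here; the sum of the limits is defined because the other limit is
   0. *)
- by rewrite fin_num_adde_defl.
- by apply: cvgeZl => //; exact: cvg_eGamma.
- apply: cvg_EFin; first exact: nearW.
  rewrite -(subrr (0 : R)); apply: cvgB; last exact: cvg_powR_expRN_natr.
  exact: cvg_powR_expRN_invn.
Qed.

Lemma eGamma1 (R : realType) : eGamma 1 = 1%E :> \bar R.
Proof.
have -> : eGamma 1 = (\int[lebesgue_measure]_(t in [set` `](0 : R)%R, +oo[%R]) (expR (- t))%:E)%E :> \bar R.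
  by apply: eq_integral => t _; rewrite /euler_kernel subrr powRr0 mul1r.
rewrite integral_itv_obnd_cbnd; last first.
  apply/measurable_EFinP; apply: measurable_funTS.
  by apply: measurableT_comp => //; exact: measurable_funN.
rewrite (@ge0_continuous_FTC2y R (fun t => expR (- t)) (fun t => - expR (- t)) 0 0).
- by rewrite oppr0 expR0 sub0e EFinN oppeK.
- by move=> x _; exact: expR_ge0.
- by apply: continuous_subspaceT; exact: continuous_expRN.
- rewrite -oppr0; apply: cvgN; exact: cvgr_expR.
- by move=> x _; case: (is_deriveN_expRN R x).
- apply: cvgN; apply: cvg_at_right_filter; exact: continuous_expRN.
- by move=> x _; rewrite derive1E; case: (is_deriveN_expRN R x).
Qed.

Lemma eGamma_natr_lty (R : realType) (n : nat) : (eGamma (n.+1%:R : R) < +oo)%E.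
Proof.
elim: n => [|n IH]; first by rewrite eGamma1 ltry.
rewrite -[n.+2]addn1 natrD eGammaD1//.
by rewrite lte_mul_pinfty// lee_fin ler0n.
Qed.

(** By the functional equation it suffices to treat s + 1, where t^s <= 1 + t^m covers both small
    and large t and reduces to the integer arguments 1 and m + 1. *)
Lemma eGamma_lty (R : realType) (s : R) : 0 < s -> (eGamma s < +oo)%E.
Proof.
move=> s0.
suff H : (eGamma (s + 1) < +oo)%E.
  move: H; rewrite eGammaD1//; have := eGamma_ge0 R s.
  by case: (eGamma s) => // [r _ _|]; rewrite ?ltry// gt0_muley ?lte_fin.
pose m := (Num.truncn s).+1.
have sm : s <= m%:R by rewrite ltW// truncnS_gt.
have kb (t : R) : 0 < t ->
    euler_kernel (s + 1) t <= euler_kernel 1 t + euler_kernel m.+1%:R t.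
  move=> t0; rewrite (addrC s) -nat1r !euler_kernelD//.
  rewrite -[X in _ <= X + _]mul1r -mulrDl ler_wpM2r ?euler_kernel_ge0//.
  have [t1|t1] := leP t 1.
    rewrite (@le_trans _ _ (t `^ 0))//; last by rewrite powRr0 lerDl powR_ge0.
    by apply: ger_powR; rewrite ?t0// ltW.
  rewrite (@le_trans _ _ (t `^ m%:R))//; last by rewrite lerDr.
  by apply: ler_powR => //; rewrite ltW.
apply: (@le_lt_trans _ _ (eGamma 1 + eGamma m.+1%:R)%E); last first.
  by apply: lte_add_pinfty; [rewrite eGamma1 ltry | exact: eGamma_natr_lty].
rewrite /eGamma -ge0_integralD//; last first.
- exact: measurable_euler_kernel.
- by move=> t _; rewrite lee_fin euler_kernel_ge0.
- exact: measurable_euler_kernel.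
- by move=> t _; rewrite lee_fin euler_kernel_ge0.
apply: ge0_le_integral => //.
- by move=> t _; rewrite lee_fin euler_kernel_ge0.
- exact: measurable_euler_kernel.
- by apply: emeasurable_funD; exact: measurable_euler_kernel.
- by move=> t /=; rewrite in_itv/= andbT => t0; rewrite -EFinD lee_fin kb.
Qed.

(** The real integral in [Gamma] is [fine] of the extended one, so finiteness is what makes the two
    agree. *)
Lemma GammaE (R : realType) (s : R) : 0 < s -> eGamma s = (Gamma s)%:E.
Proof.
move=> s0; rewrite [RHS](@fineK _ (eGamma s))//.
by rewrite ge0_fin_numE ?eGamma_ge0// eGamma_lty.
Qed.

Lemma GammaD1 (R : realType) (s : R) : 0 < s -> Gamma (s + 1) = s * Gamma s.
Proof.
by move=> s0; apply: EFin_inj; rewrite EFinM -!GammaE ?addr_gt0// eGammaD1.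
Qed.

Lemma Gamma_gt0 (R : realType) (s : R) : 0 < s -> 0 < Gamma s.
Proof.
move=> s0; rewrite -lte_fin -GammaE//.
(* A lower bound of the kernel on [1, 2]: there t^(s-1) >= 1/t >= 1/2 since s > 0, and exp(-t) >=
   exp(-2). *)
pose c : R := expR (- 2) / 2.
have c0 : 0 < c by rewrite divr_gt0// expR_gt0.
apply: (@lt_le_trans _ _ (\int[lebesgue_measure]_(t in [set` `[(1 : R)%R, (2 : R)%R]]) c%:E)%E).
  rewrite integral_cst//= lebesgue_measure_itv/= lte_fin ltr1n/= -EFinB -EFinM lte_fin.
  by rewrite mulr_gt0// subr_gt0 ltr1n.
apply: (@le_trans _ _ (\int[lebesgue_measure]_(t in [set` `[(1 : R)%R, (2 : R)%R]]) (euler_kernel s t)%:E)%E).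
  apply: ge0_le_integral => //.
  - by move=> t _; rewrite lee_fin ltW.
  - exact: measurable_euler_kernel.
  - move=> t; rewrite /= in_itv/= => /andP[t1 t2].
    have t0 : 0 < t by apply: lt_le_trans t1.
    rewrite lee_fin /c mulrC ler_pM ?invr_ge0 ?expR_ge0//; last by rewrite ler_expR lerN2.
    rewrite (@le_trans _ _ (t `^ (-1)))//.
      by rewrite powR_inv1 ?(ltW t0)// lef_pV2 ?posrE.
    by apply: ler_powR => //; rewrite lerBDr addNr (ltW s0).
apply: ge0_subset_integral => //.
- exact: measurable_euler_kernel.
- by move=> t _; rewrite lee_fin euler_kernel_ge0.
- move=> t; rewrite /= !in_itv/= andbT => /andP[t1 _]; exact: lt_le_trans t1.
Qed.

(** * Logarithm inequalities and Wendel's bound *)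

Lemma lnB_le (R : realType) (a b : R) : 0 < a -> 0 < b -> ln b - ln a <= (b - a) / a.
Proof.
move=> a0 b0; rewrite -ln_div ?posrE// (_ : b / a = 1 + (b - a) / a).
  apply: le_ln1Dx; rewrite ltr_pdivlMr// mulN1r; lra.
by field; rewrite gt_eqF.
Qed.

Lemma lnB_ge (R : realType) (a b : R) : 0 < a -> 0 < b -> (b - a) / b <= ln b - ln a.
Proof. by move=> a0 b0; rewrite -lerN2 opprB -mulNr opprB lnB_le. Qed.

(** Weighted AM-GM for [x] and 1: the tangent bounds of [ln] at their mean [m], taken with weights p
    and 1 - p, add up with cancelling linear terms. *)
Lemma powR_le_tangent (R : realType) (p x : R) : 0 <= p <= 1 -> 0 < x ->
  x `^ p <= (1 - p) + p * x.
Proof.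
move=> /andP[p0 p1] x0; set m := _ + _.
have m0 : 0 < m.
  have [p00|pn0] := eqVneq p 0; first by rewrite /m p00; lra.
  by rewrite /m ltr_wpDl ?subr_ge0// mulr_gt0// lt_def pn0.
rewrite -ler_ln ?posrE ?powR_gt0// ln_powR.
have h1 : p * (ln x - ln m) <= p * ((x - m) / m) by rewrite ler_wpM2l ?lnB_le.
have h2 : (1 - p) * (ln 1 - ln m) <= (1 - p) * ((1 - m) / m).
  by rewrite ler_wpM2l ?lnB_le ?subr_ge0.
have h3 : p * ((x - m) / m) + (1 - p) * ((1 - m) / m) = 0.
  by rewrite /m; field; rewrite gt_eqF.
rewrite ln1 in h2; lra.
Qed.

(* One half of Wendel's inequality; the other half is this one for [s + p] and [1 - p]. *)
Lemma GammaD_le (R : realType) (s p : R) : 0 < s -> 0 <= p <= 1 ->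
  Gamma (s + p) <= s `^ p * Gamma s.
Proof.
move=> s0 p01; have /andP[p0 p1] := p01.
have sp0 : 0 < s + p by rewrite ltr_wpDr.
(* The tangent inequality is applied to t / s: with this scale the right side integrates, by the
   functional equation, to exactly s^p Gamma(s). *)
have kb (t : R) : 0 < t -> euler_kernel (s + p) t <=
    s `^ p * (1 - p) * euler_kernel s t + s `^ p * (p / s) * euler_kernel (s + 1) t.
  move=> t0; rewrite !euler_kernelD// powRr1 ?(ltW t0)//.
  rewrite [X in _ <= _ + X]mulrA -mulrDl ler_wpM2r ?euler_kernel_ge0//.
  have -> : t `^ p = s `^ p * (t / s) `^ p.
    rewrite -powRM ?divr_ge0 ?(ltW t0) ?(ltW s0)// mulrC divfK// gt_eqF//.
  rewrite -!mulrA -mulrDr ler_wpM2l ?powR_ge0// (mulrC _ t).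
  by apply: powR_le_tangent => //; rewrite divr_gt0.
have c0 : 0 <= s `^ p * (1 - p) by rewrite mulr_ge0 ?powR_ge0 ?subr_ge0.
have c1 : 0 <= s `^ p * (p / s) by rewrite mulr_ge0 ?powR_ge0 ?divr_ge0 ?(ltW s0).
suff : (eGamma (s + p) <=
    (s `^ p * (1 - p))%:E * eGamma s + (s `^ p * (p / s))%:E * eGamma (s + 1))%E.
  rewrite (GammaE _ _ sp0) (GammaE _ _ s0) (GammaE _ _ (addr_gt0 s0 ltr01)) -!EFinM -EFinD lee_fin => /le_trans; apply.
  rewrite GammaD1// le_eqVlt; apply/orP; left; apply/eqP.
  by field; rewrite gt_eqF.
have m1 := @measurable_euler_kernel R s [set` `]0%R, +oo[].
have m2 := @measurable_euler_kernel R (s + 1) [set` `]0%R, +oo[].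
have k0 u (t : R) : (0 <= (euler_kernel u t)%:E)%E by rewrite lee_fin euler_kernel_ge0.
rewrite /eGamma -!ge0_integralZl_EFin// -ge0_integralD//.
- apply: ge0_le_integral => //.
  + exact: measurable_euler_kernel.
  + by apply: emeasurable_funD; exact: measurable_funeM.
  + by move=> t /=; rewrite in_itv/= andbT => t0; rewrite -!EFinM -EFinD lee_fin kb.
- by move=> t _; rewrite mule_ge0.
- exact: measurable_funeM.
- by move=> t _; rewrite mule_ge0.
- exact: measurable_funeM.
Qed.

(** * Increments of log Gamma *)

Definition lnGamma {R : realType} (s : R) : R := ln (Gamma s).

Lemma lnGammaB_le (R : realType) (s p : R) : 0 < s -> 0 <= p <= 1 ->
  lnGamma (s + p) - lnGamma s <= p * ln s.
Proof.
move=> s0 p01; have /andP[p0 p1] := p01.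
have sp0 : 0 < s + p by rewrite ltr_wpDr.
rewrite /lnGamma lerBlDr -ln_powR -lnM ?posrE ?powR_gt0 ?Gamma_gt0//.
by rewrite ler_ln ?posrE ?mulr_gt0 ?powR_gt0 ?Gamma_gt0// GammaD_le.
Qed.

Lemma lnGammaD1 (R : realType) (s : R) : 0 < s ->
  lnGamma (s + 1) = ln s + lnGamma s.
Proof. by move=> s0; rewrite /lnGamma GammaD1// lnM ?posrE ?Gamma_gt0. Qed.

(** The upper bound from s + p to s + 1, with increment 1 - p, gives the lower estimate ln s - (1 -
    p) ln(s + p); then ln(s + p) - ln s <= p / s. *)
Lemma lnGammaB_ge (R : realType) (s p : R) : 0 < s -> 0 <= p <= 1 ->
  p * (ln s - s^-1) <= lnGamma (s + p) - lnGamma s.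
Proof.
move=> s0 p01; have /andP[p0 p1] := p01.
have sp0 : 0 < s + p by rewrite ltr_wpDr.
have := @lnGammaB_le R (s + p) (1 - p) sp0.
rewrite (_ : s + p + (1 - p) = s + 1); last by ring.
rewrite (lnGammaD1 _ _ s0) subr_ge0 p1 gerBl p0 => /(_ isT) h.
have h2 := lnB_le _ _ _ s0 sp0; rewrite (addrC s) addrK in h2.
have h3 : p * ln s <= p * ln (p + s) by rewrite ler_wpM2l// ler_ln ?posrE ?(addrC p)// lerDl.
rewrite (addrC p) in h2 h3.
move: (lnGamma s) (lnGamma (s + p)) (ln s) (ln (s + p)) h h2 h3 => a b c d.
lra.
Qed.

Lemma lnGammaDn (R : realType) (s : R) (M : nat) : 0 < s ->
  lnGamma (s + M%:R) = lnGamma s + \sum_(0 <= k < M) ln (s + k%:R).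
Proof.
move=> s0; elim: M => [|M IH]; first by rewrite big_nil !addr0.
rewrite big_nat_recr//= addrA -IH -natr1 addrA.
by rewrite (lnGammaD1 _ (s + M%:R)) ?ltr_wpDr// addrC.
Qed.

(** Subtracted from ln(s + M), this is the approximant whose limit in M is psi(s). *)
Definition inv_sum {R : realType} (M : nat) (s : R) : R :=
  \sum_(0 <= k < M) (s + k%:R)^-1.

(** Shifting both arguments by M turns the Wendel error 1/s into 1/(s + M). The price is a sum of
    ln(s + p + k) - ln(s + k), each lying between p/(s + p + k) and p/(s + k). *)
Lemma lnGammaB_bounds (R : realType) (s p : R) (M : nat) : 0 < s -> 0 <= p <= 1 ->
  p * (ln (s + M%:R) - (s + M%:R)^-1 - inv_sum M s) <= lnGamma (s + p) - lnGamma s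
    <= p * (ln (s + M%:R) - inv_sum M (s + p)).
Proof.
move=> s0 p01; have /andP[p0 p1] := p01.
have sM0 : 0 < s + M%:R by rewrite ltr_wpDr.
have hi := lnGammaB_le _ _ _ sM0 p01; have lo := lnGammaB_ge _ _ _ sM0 p01.
rewrite addrAC !lnGammaDn// ?ltr_wpDr// in hi lo.
have lnk (k : nat) : p * (s + p + k%:R)^-1 <= ln (s + p + k%:R) - ln (s + k%:R)
    <= p * (s + k%:R)^-1.
  have a0 : 0 < s + k%:R by rewrite ltr_wpDr.
  have b0 : 0 < s + p + k%:R by rewrite !ltr_wpDr.
  have e : s + p + k%:R - (s + k%:R) = p by ring.
  by have := lnB_le _ _ _ a0 b0; have := lnB_ge _ _ _ a0 b0; rewrite e => -> ->.
have Tlo : p * inv_sum M (s + p) <=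
    \sum_(0 <= k < M) ln (s + p + k%:R) - \sum_(0 <= k < M) ln (s + k%:R).
  by rewrite -sumrB mulr_sumr; apply: ler_sum => k _; case/andP: (lnk k).
have Thi : \sum_(0 <= k < M) ln (s + p + k%:R) - \sum_(0 <= k < M) ln (s + k%:R) <=
    p * inv_sum M s.
  by rewrite -sumrB mulr_sumr; apply: ler_sum => k _; case/andP: (lnk k).
move: (\sum_(0 <= k < M) ln (s + p + k%:R)) (\sum_(0 <= k < M) ln (s + k%:R)) hi lo Tlo Thi => A B.
move: (inv_sum M s) (inv_sum M (s + p)) => C D.
move: (lnGamma s) (lnGamma (s + p)) (ln (s + M%:R)) (s + M%:R)^-1 => a b c d.
by move=> hi lo Tlo Thi; apply/andP; split; lra.
Qed.

(** The bound is uniform in M, so it survives the limit: the termwise differences are dominated by a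
    telescoping series. *)
Lemma inv_sumB_le (R : realType) (s p : R) (M : nat) : 2^-1 <= s -> 0 <= p ->
  inv_sum M s - inv_sum M (s + p) <= 8 * p.
Proof.
move=> s12 p0.
have s0 : 0 < s by lra.
suff H : inv_sum M s - inv_sum M (s + p) <= 8 * p * (1 - M.+1%:R^-1).
  by apply: (le_trans H); rewrite mulrBr mulr1 gerBl !mulr_ge0// invr_ge0.
elim: M => [|M IH]; first by rewrite /inv_sum !big_nil invr1; lra.
rewrite /inv_sum !big_nat_recr//= -!/(inv_sum _ _).
have M0 : 0 <= M%:R :> R by [].
have step : (s + M%:R)^-1 - (s + p + M%:R)^-1 <=
    8 * p * (M.+1%:R^-1 - M.+2%:R^-1).
  rewrite -(natr1 M.+1) -(natr1 M); move: (M%:R : R) M0 => m m0.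
  have -> : (s + m)^-1 - (s + p + m)^-1 = p / ((s + m) * (s + p + m)).
    by field; apply/andP; split; rewrite gt_eqF//; lra.
  have -> : 8 * p * ((m + 1)^-1 - (m + 1 + 1)^-1) = 8 * p / ((m + 1) * (m + 2)).
    by field; apply/andP; split; rewrite gt_eqF//; lra.
  rewrite ler_pdivrMr ?mulr_gt0//; [|lra|lra].
  rewrite mulrAC ler_pdivlMr ?mulr_gt0//; [|lra|lra].
  (* Since s >= 1/2, it is enough that (m+1)(m+2) <= 8 (m + 1/2)^2, an equality at m = 0: hence the
     constant 8. *)
  rewrite (mulrC 8) -mulrA ler_wpM2l//; nra.
rewrite opprD addrACA (le_trans (lerD IH step))// -mulrDr.
by rewrite addrA subrK.
Qed.

(** * Difference quotients and the derivative of log Gamma *)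

Lemma cvg_aff_harmonic (R : realType) (D : nat -> R) (l a b p : R) :
  D @ \oo --> l -> (fun M => p * (D M + a * M.+1%:R^-1 + b)) @ \oo --> p * (l + b).
Proof.
move=> Dl; rewrite -[l in X in _ --> X]addr0 -(mulr0 a).
apply: cvgMl_tmp; apply: cvgD; last exact: cvg_cst.
by apply: cvgD => //; apply: cvgMl_tmp; exact: cvg_harmonic.
Qed.

Lemma invD_harmonic (R : realType) (s : R) (M : nat) : 2^-1 <= s -> (s + M%:R)^-1 <= 2 * M.+1%:R^-1.
Proof.
move=> s12; have M0 : 0 <= M%:R :> R by [].
have sM0 : 0 < s + M%:R by lra.
by rewrite -ler_pdivrMl// -invfM lef_pV2 ?posrE ?mulr_gt0// -(natr1 M); lra.
Qed.

Lemma lnGamma_slope_right (R : realType) (x l p : R) : 1 <= x ->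
  (fun M => ln (x + M%:R) - inv_sum M x) @ \oo --> l ->
  0 <= p <= 2^-1 ->
  p * (l - 8 * p) <= lnGamma (x + p) - lnGamma x <= p * (l + 8 * p).
Proof.
move=> x1 Dl /andP[p0 p12].
have x0 : 0 < x by lra.
have x12 : 2^-1 <= x by lra.
have p01 : 0 <= p <= 1 by rewrite p0/=; lra.
apply/andP; split.
  (* The term -2/(M+1) absorbs the error 1/(x + M) and disappears in the limit. *)
  have H := @cvg_aff_harmonic R _ l (- 2) (- (8 * p)) p Dl.
  apply: (cvgr_to_le H); apply: nearW => M /=.
  have /andP[h _] := lnGammaB_bounds _ _ _ M x0 p01.
  apply: le_trans h; rewrite ler_wpM2l//.
  have := invD_harmonic _ _ M x12.
  move: (x + M%:R)^-1 M.+1%:R^-1 (ln _) (inv_sum M x) => a b c d.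
  lra.
have H := @cvg_aff_harmonic R _ l 0 (8 * p) p Dl.
apply: (cvgr_to_ge H); apply: nearW => M /=.
have /andP[_ h] := lnGammaB_bounds _ _ _ M x0 p01.
apply: (le_trans h); rewrite ler_wpM2l//.
have := inv_sumB_le _ _ _ M x12 p0.
move: (ln _) (inv_sum M x) (inv_sum M (x + p)) => a b c.
by clear h; rewrite mul0r addr0; lra.
Qed.

(** The increment now starts at x - p, which stays at least 1/2 so that [inv_sumB_le] applies; the
    limit [l] is still taken at [x], so the bounds must be moved from x - p to x. *)
Lemma lnGamma_slope_left (R : realType) (x l p : R) : 1 <= x ->
  (fun M => ln (x + M%:R) - inv_sum M x) @ \oo --> l ->
  0 <= p <= 2^-1 ->
  p * (l - 8 * p) <= lnGamma x - lnGamma (x - p) <= p * (l + 8 * p).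
Proof.
move=> x1 Dl /andP[p0 p12].
have s12 : 2^-1 <= x - p by lra.
have s0 : 0 < x - p by lra.
have x0 : 0 < x by lra.
have p01 : 0 <= p <= 1 by rewrite p0/=; lra.
have M0 M : 0 <= M%:R :> R by [].
apply/andP; split.
  (* Two errors of size 1/(x - p + M) occur, one from Wendel's bound and one from moving the
     logarithm; each is at most 2/(M+1). *)
  have H := @cvg_aff_harmonic R _ l (- 4) (- (8 * p)) p Dl.
  apply: (cvgr_to_le H); apply: nearW => M /=.
  have /andP[h _] := lnGammaB_bounds _ _ _ M s0 p01.
  rewrite subrK in h.
  apply: le_trans h; rewrite ler_wpM2l//.
  have h1 := invD_harmonic _ _ M s12.
  have h2 := inv_sumB_le _ _ _ M s12 p0.
  rewrite subrK in h2.
  have h3 : ln (x + M%:R) - ln (x - p + M%:R) <= (x - p + M%:R)^-1.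
    have a0 : 0 < x - p + M%:R by rewrite ltr_wpDr.
    have b0 : 0 < x + M%:R by rewrite ltr_wpDr.
    apply: (le_trans (lnB_le _ _ _ a0 b0)).
    rewrite ler_piMl ?invr_ge0 ?(ltW a0)//.
    by rewrite (_ : _ - _ = p); [case/andP: p01|ring].
  move: (inv_sum M x) (inv_sum M (x - p)) (ln (x + M%:R)) (ln (x - p + M%:R)) h2 h3 => a b c d.
  move: (x - p + M%:R)^-1 M.+1%:R^-1 h1 => e f.
  lra.
have H := @cvg_aff_harmonic R _ l 0 (8 * p) p Dl.
apply: (cvgr_to_ge H); apply: nearW => M /=.
have /andP[_ h] := lnGammaB_bounds _ _ _ M s0 p01.
rewrite subrK in h.
apply: (le_trans h); rewrite ler_wpM2l//.
have : ln (x - p + M%:R) <= ln (x + M%:R).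
  have a0 : 0 < x - p + M%:R by rewrite ltr_wpDr.
  have b0 : 0 < x + M%:R by rewrite ltr_wpDr.
  by rewrite ler_ln ?posrE// lerD2r gerBl.
move: (ln (x + M%:R)) (ln (x - p + M%:R)) (inv_sum M x) => a b c.
by clear h; rewrite mul0r addr0; lra.
Qed.

Lemma derive1_lnGamma (R : realType) (x l : R) : 1 <= x ->
  (fun M => ln (x + M%:R) - inv_sum M x) @ \oo --> l ->
  derive1 lnGamma x = l.
Proof.
move=> x1 Dl; apply: cvg_lim => //; apply/cvgrPdist_le => e e0.
near=> h.
have hn0 : h != 0 by near: h; exact: nbhs_dnbhs_neq.
have h12 : `|h| <= 2^-1.
  by near: h; apply: dnbhs0_le.
have he : `|h| <= e / 8.
  by near: h; apply: dnbhs0_le; rewrite divr_gt0.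
change (`|l - h^-1 * (lnGamma (h + x) - lnGamma x)| <= e).
(* With the denominator cleared, both signs of [h] lead to the same quadratic error, read off from
   the two one-sided slope bounds. *)
suff H : `|h * l - (lnGamma (h + x) - lnGamma x)| <= 8 * `|h| ^+ 2.
  rewrite (_ : l - _ = h^-1 * (h * l - (lnGamma (h + x) - lnGamma x))).
    rewrite normrM normfV ler_pdivrMl ?normr_gt0// (le_trans H)// expr2 mulrA.
    by rewrite mulrC ler_wpM2l// mulrC -ler_pdivlMr.
  by rewrite [RHS]mulrBr mulKf.
have [h0|h0] := leP 0 h.
  have hh : 0 <= h <= 2^-1 by rewrite h0 -(ger0_norm h0).
  have := lnGamma_slope_right _ _ _ _ x1 Dl hh; rewrite (addrC h) (ger0_norm h0) ler_norml.
  move: (lnGamma (x + h)) (lnGamma x) => A B; rewrite expr2.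
  by move=> /andP[a b]; apply/andP; split; lra.
have hh : 0 <= - h <= 2^-1 by rewrite -(ltr0_norm h0) h12 normr_ge0.
have := lnGamma_slope_left _ _ _ _ x1 Dl hh; rewrite opprK (addrC h) (ltr0_norm h0) ler_norml.
move: (lnGamma (x + h)) (lnGamma x) => A B; rewrite expr2.
by move=> /andP[a b]; apply/andP; split; lra.
Unshelve. all: by end_near. Qed.

(** * Harmonic sums, Euler's constant and digamma at positive integers *)

Lemma harmonic_numberS (R : realType) (m : nat) :
  harmonic_number m.+1 = harmonic_number m + m.+1%:R^-1 :> R.
Proof. by rewrite /harmonic_number big_nat_recr. Qed.

Lemma harmonic_number0 (R : realType) : harmonic_number 0 = 0 :> R.
Proof. by rewrite /harmonic_number big_geq. Qed.

Lemma lnS_bounds (R : realType) (m : nat) :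
  m.+2%:R^-1 <= ln (m.+2%:R : R) - ln m.+1%:R <= m.+1%:R^-1.
Proof.
have e : m.+2%:R - m.+1%:R = 1 :> R by rewrite -(natr1 m.+1) addrAC subrr add0r.
have a0 : 0 < m.+1%:R :> R by [].
have b0 : 0 < m.+2%:R :> R by [].
by have := lnB_le _ _ _ a0 b0; have := lnB_ge _ _ _ a0 b0; rewrite e !mul1r => -> ->.
Qed.

Lemma cvg_euler_mascheroni (R : realType) :
  (fun m : nat => harmonic_number m.+1 - ln (m.+1%:R : R)) @ \oo --> euler_mascheroni.
Proof.
pose a (m : nat) : R := harmonic_number m - ln m%:R.
(* The shift is essential for monotonicity: [ln 0] is 0 by default, so a 0 = 0 < 1 = a 1, and the
   sequence decreases only from index 1 on. *)
have cv : cvgn (fun m => a m.+1).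
  apply: nonincreasing_is_cvgn.
    apply/nonincreasing_seqP => m; rewrite /a (harmonic_numberS _ m.+1).
    case/andP: (lnS_bounds R m) => h _.
    by rewrite -addrA lerD2l lerBlDr addrC.
  exists 0 => _ [m _ <-]; rewrite /a subr_ge0.
  (* This sharper bound, with harmonic index m rather than m + 1, matches the upper half of
     [lnS_bounds] in the induction. *)
  suff H : ln m.+1%:R <= harmonic_number m :> R.
    by rewrite (le_trans H)// harmonic_numberS lerDl invr_ge0.
  elim: m => [|m IH]; first by rewrite ln1 harmonic_number0.
  case/andP: (lnS_bounds R m) => _ h.
  rewrite harmonic_numberS.
  by rewrite -(subrK (ln m.+1%:R) (ln m.+2%:R)) addrC lerD.
have cva : a @ \oo --> limn (fun m => a m.+1) by rewrite -cvg_shiftS.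
by rewrite /euler_mascheroni -/a (cvg_lim _ cva).
Qed.

Lemma inv_sum_natr (R : realType) (n M : nat) :
  inv_sum M n.+1%:R = harmonic_number (n + M) - harmonic_number n :> R.
Proof.
elim: M => [|M IH]; first by rewrite /inv_sum big_nil addn0 subrr.
rewrite /inv_sum big_nat_recr//= -/(inv_sum _ _) IH addnS harmonic_numberS.
by rewrite -natrD addSn addrAC.
Qed.

Lemma digamma_natr (R : realType) (n : nat) :
  digamma (n.+1%:R : R) = harmonic_number n - euler_mascheroni.
Proof.
apply: derive1_lnGamma; first by rewrite ler1n.
(* The added reciprocal raises the harmonic index from M + n to M + n + 1, the argument of the
   logarithm, so that Euler's sequence appears. *)
have -> : (fun M => ln (n.+1%:R + M%:R) - inv_sum M n.+1%:R) =
    (fun M => harmonic_number n - (harmonic_number (M + n).+1 - ln (M + n).+1%:R)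
       + (M + n).+1%:R^-1) :> (nat -> R).
  apply/funext => M; rewrite inv_sum_natr -natrD addSn addnC harmonic_numberS.
  ring.
rewrite -[X in _ --> X]addr0; apply: cvgD.
  apply: cvgB; first exact: cvg_cst.
  have := @cvg_euler_mascheroni R; rewrite -(cvg_shiftn n); exact.
have /(_ R) := @cvg_harmonic; rewrite -(cvg_shiftn n); exact.
Qed.

(** Starting from -H_n, each even denominator 2k must be compensated by 2/(2k) = 1/k, and these
    corrections sum to H at the integer part of n/2. *)
Lemma alternating_harmonic (R : realType) (n : nat) :
  \sum_(0 <= j < n) (-1) ^+ j.+1 / j.+1%:R =
  harmonic_number (n %/ 2) - harmonic_number n :> R.
Proof.
rewrite divn2; elim: n => [|n IH]; first by rewrite big_nil subrr.
rewrite big_nat_recr//= IH [in RHS]harmonic_numberS -signr_odd /= uphalf_half.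
have [on|on] := boolP (odd n); last by rewrite add0n expr1; ring.
have -> : n.+1%:R = 2 * (n./2).+1%:R :> R.
  by rewrite -natrM -[in LHS](odd_double_half n) on mul2n doubleS.
rewrite add1n harmonic_numberS expr0.
by field; rewrite nat1r pnatr_eq0.
Qed.

(** * Evaluation of y(n, 1/2) *)

Theorem theorem8 (R : realType) (n : nat) :
  ynum n (1 / 2 : R) =
  2 ^+ (n + 2) *
    ((-1) ^+ n.+1 / n.+1%:R + harmonic_number (n %/ 2)
     - euler_mascheroni - digamma n.+1%:R).
Proof.
rewrite digamma_natr.
(* Euler's constant cancels, leaving -H_n; the isolated fraction on the right is the last term, j =
   n, of the alternating sum. *)
transitivity (2 ^+ (n + 2) * \sum_(0 <= j < n.+1) (-1) ^+ j.+1 / j.+1%:R : R); last first.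
  congr (_ * _); rewrite big_nat_recr//= alternating_harmonic; ring.
rewrite /ynum big_distrr/=; apply: eq_big_nat => j /andP[_ jn].
have jn' : (j <= n.+1)%N by rewrite ltnW.
(* At 1/2 the two bases differ only in sign, and their exponents add up to n + 2 for every j. *)
have e2 : (2^-1 : R) ^+ j.+1 * 2^-1 ^+ (n.+1 - j) = (2 ^+ (n + 2))^-1.
  by rewrite -exprD addSn subnKC// addn2 exprVn.
(* The second factor cancels the sign of (-1/2)^(n+1-j), so the sign (-1)^(j+1) remains. *)
have sgn : (-1) ^+ n = (-1) ^+ j.+1 * (-1) ^+ (n.+1 - j) :> R.
  by rewrite -exprD addSn subnKC// 2!exprS !mulN1r opprK.
rewrite div1r (_ : 2^-1 - 1 = -1 * 2^-1 :> R); last by field.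
rewrite exprMn (mulrCA (_ * _)) -mulrA e2 sgn.
by rewrite invfM [LHS]mulrA mulfK ?signr_eq0// invf_div; ring.
Qed.
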